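(* Let $m\ge 3$ and $n\ge 3$. The Kirchhoff index of the complete flower graph $F_n(K_m)$ is $$Kf(F_n(K_m))=\frac{n\left(5+12n+n^2+m^2(-1+6n+n^2)-m(1+18n+2n^2)\right)}{6m}.$$
   Context: For a connected graph $H$ with vertex set $\{1,\dots,N\}$ and Laplacian matrix $L$, the resistance distance between vertices $i,j$ is $r_H(i,j)=(e_i-e_j)^T L^\dagger (e_i-e_j)$, where $e_i$ is the $i$th standard unit vector and $L^\dagger$ is the Moore–Penrose pseudoinverse of $L$. The Kirchhoff index is $Kf(H)=\frac12\sum_{i,j\in V(H)} r_H(i,j)$ (sum over ordered pairs). Complete flower graph: for $m\ge3$, $n\ge 3$, fix two distinct vertices $x,y$ of the complete graph $K_m$ (the choice is irrelevant up to isomorphism). $F_n(K_m)$ is obtained from $n$ vertex-disjoint copies $G_1,\dots,G_n$ of $K_m$, with $x_i,y_i$ the copies of $x,y$ in $G_i$, by identifying $y_i$ with $x_{i+1}$ for $1\le i<n$ and $y_n$ with $x_1$. *)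

(* Defs.v *)
From HB Require Import structures.
From mathcomp Require Import all_boot all_order all_algebra.

Set Implicit Arguments.
Unset Strict Implicit.
Unset Printing Implicit Defensive.

Import Order.TTheory GRing.Theory Num.Theory.

Local Open Scope ring_scope.

Section MoorePenrose.
Variable R : realFieldType.

Definition is_pinv (p q : nat) (A : 'M[R]_(p, q)) (B : 'M[R]_(q, p)) : bool :=
  [&& A *m B *m A == A, B *m A *m B == B,
      (A *m B)^T == A *m B & (B *m A)^T == B *m A].

Lemma row_free_gram_unit (p q : nat) (A : 'M[R]_(p, q)) :
  row_free A -> A *m A^T \in unitmx.
Proof.
move=> freeA; rewrite -row_free_unit -kermx_eq0; apply/eqP/row_matrixP => i.
rewrite row0; set u := row i _.
have uAA : u *m (A *m A^T) = 0 by apply/sub_kermxP; exact: row_sub.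
have uA0 : u *m A = 0.
  have nrm0 : ((u *m A) *m (u *m A)^T) 0 0 = 0.
    by rewrite trmx_mul mulmxA -(mulmxA u) uAA mul0mx mxE.
  move: nrm0; rewrite mxE => nrm0.
  have sq0 j : (u *m A) 0 j * (u *m A)^T j 0 = 0.
    apply/eqP; move/eqP: nrm0; rewrite psumr_eq0 => [/allP/(_ j)|k _].
      by rewrite mem_index_enum => /(_ isT).
    by rewrite [X in _ * X]mxE -expr2 sqr_ge0.
  apply/rowP => j; rewrite [RHS]mxE; apply/eqP; rewrite -sqrf_eq0 expr2.
  by move: (sq0 j); rewrite [X in _ * X]mxE => ->.
by apply: (row_free_inj freeA); rewrite uA0 mul0mx.
Qed.

Lemma pinv_exists (p q : nat) (A : 'M[R]_(p, q)) : exists B, is_pinv A B.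
Proof.
pose C := col_base A; pose D := row_base A.
have CD : C *m D = A by exact: mulmx_base.
have fD : row_free D by exact: row_base_free.
have fC : row_full C by exact: col_base_full.
clearbody C D.
have uD : D *m D^T \in unitmx by exact: row_free_gram_unit.
have uC : C^T *m C \in unitmx.
  rewrite -{2}[C]trmxK; apply: row_free_gram_unit.
  by rewrite /row_free mxrank_tr.
pose Dr := D^T *m invmx (D *m D^T); pose Cl := invmx (C^T *m C) *m C^T.
have DDr : D *m Dr = 1%:M by rewrite mulmxA mulmxV.
have ClC : Cl *m C = 1%:M by rewrite -mulmxA mulVmx.
exists (Dr *m Cl).
have AX r (X : 'M_(q, r)) : A *m X = C *m (D *m X) by rewrite mulmxA CD.
have XA r (X : 'M_(r, p)) : X *m A = X *m C *m D by rewrite -mulmxA CD.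
have AB : A *m (Dr *m Cl) = C *m Cl by rewrite AX (mulmxA D) DDr mul1mx.
have BA : Dr *m Cl *m A = Dr *m D by rewrite XA -(mulmxA Dr) ClC mulmx1.
have symI k (S : 'M[R]_k) : S^T = S -> (invmx S)^T = invmx S.
  by move=> SS; rewrite trmx_inv SS.
apply/and4P; split; apply/eqP.
- by rewrite AB XA -(mulmxA C) ClC mulmx1.
- by rewrite BA mulmxA -(mulmxA Dr) DDr mulmx1.
- rewrite AB /Cl !trmx_mul trmxK symI; last by rewrite trmx_mul trmxK.
  by rewrite mulmxA.
- rewrite BA /Dr !trmx_mul trmxK symI; last by rewrite trmx_mul trmxK.
  by rewrite mulmxA.
Qed.

Definition pinv (p q : nat) (A : 'M[R]_(p, q)) : 'M[R]_(q, p) :=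
  xchoose (pinv_exists A).

Lemma pinvP (p q : nat) (A : 'M[R]_(p, q)) : is_pinv A (pinv A).
Proof. exact: xchooseP. Qed.

Lemma pinv_unique (p q : nat) (A : 'M[R]_(p, q)) (B : 'M[R]_(q, p)) :
  is_pinv A B -> B = pinv A.
Proof.
have /and4P[/eqP a1 /eqP a2 /eqP a3 /eqP a4] := pinvP A; move: a1 a2 a3 a4.
move: (pinv A) => C c1 c2 c3 c4 /and4P[/eqP b1 /eqP b2 /eqP b3 /eqP b4].
have AB : A *m B = A *m C.
  rewrite -b3 -{1}c1 -(mulmxA (A *m C)) trmx_mul b3 c3.
  by rewrite mulmxA b1.
have BA : B *m A = C *m A.
  rewrite -b4 -{1}c1 -mulmxA (mulmxA B) trmx_mul b4 c4.
  by rewrite -mulmxA (mulmxA A) b1.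
by rewrite -b2 -mulmxA AB mulmxA BA c2.
Qed.

End MoorePenrose.

(* A graph on a finite vertex type V is given by its adjacency relation; the
   matrices attached to it are indexed through enum_rank and enum_val. *)
Section Kirchhoff.
Variables (R : realFieldType) (V : finType) (e : rel V).

Definition degree_matrix : 'M[R]_#|V| :=
  diag_mx (\row_i #|[set v | e (enum_val i) v]|%:R).

Definition adjacency_matrix : 'M[R]_#|V| :=
  \matrix_(i, j) (e (enum_val i) (enum_val j))%:R.

Definition laplacian : 'M[R]_#|V| := degree_matrix - adjacency_matrix.

Definition unit_vector (v : V) : 'cV[R]_#|V| := delta_mx (enum_rank v) 0.

Definition resistance (u v : V) : R :=
  ((unit_vector u - unit_vector v)^T *m pinv laplacian
     *m (unit_vector u - unit_vector v)) 0 0.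

Definition kirchhoff_index : R := 2^-1 * \sum_u \sum_v resistance u v.

End Kirchhoff.

Definition complete_graph (m : nat) : rel 'I_m := [rel u v | u != v].

Arguments complete_graph : clear implicits.

Section Flower.
Variables (n : nat) (T : finType) (e : rel T) (x y : T).

Definition copies : rel ('I_n * T) := [rel u v | (u.1 == v.1) && e u.2 v.2].

(* ordS is the successor modulo n, so that (i, y) is glued to (i + 1, x) and
   the last copy is closed up onto the first one. *)
Definition glue_step : rel ('I_n * T) :=
  [rel u v | [&& u.2 == y, v.2 == x & v.1 == ordS u.1]].

Definition glue : rel ('I_n * T) :=
  connect [rel u v | glue_step u v || glue_step v u].

Lemma glue_refl : reflexive glue.
Proof. exact: connect0. Qed.

Lemma glue_sym : symmetric glue.
Proof. by apply: sym_connect_sym => u v /=; rewrite orbC. Qed.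

Lemma glue_trans : transitive glue.
Proof. exact: connect_trans. Qed.

Canonical glue_equiv := EquivRel glue glue_refl glue_sym glue_trans.

Definition flower_vertex := {eq_quot glue_equiv}%qT.

HB.instance Definition _ := EqQuotient.on flower_vertex.
HB.instance Definition _ := Countable.on flower_vertex.
HB.instance Definition _ : isFinite flower_vertex :=
  CanIsFinite (@reprK _ flower_vertex).

Definition flower_graph : rel flower_vertex :=
  [rel a b | (a != b) &&
     [exists u, exists v,
        [&& \pi_flower_vertex u == a, \pi_flower_vertex v == b
          & copies u v]]]%qT.

End Flower.

Arguments flower_graph n {T} e x y.

(* Main.v *)
(* The star-mesh transformation replaces each copy of K_m by a star whose m arms
   have resistance 1/m. The flower then becomes a cycle of length 2n with edge
   resistances 1/m, the cut vertices sitting at the even positions and the hubs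
   of the stars at the odd ones, with m - 2 pendant edges at each hub. This
   predicts all resistance distances. They are certified without star-mesh by a
   matrix X, equal to minus half of them up to rank-one terms, such that
   L X = I + t 1^T: then (e_u - e_v)^T L^+ (e_u - e_v) =
   (e_u - e_v)^T X (e_u - e_v). *)
Require Import Defs.
From HB Require Import structures.
From mathcomp Require Import all_boot all_order all_algebra.
From mathcomp Require Import ring lra zify.

Set Implicit Arguments.
Unset Strict Implicit.
Unset Printing Implicit Defensive.

Import Order.TTheory GRing.Theory Num.Theory.

Local Open Scope ring_scope.

(** * Resistances and the Kirchhoff index from a Green matrix *)

Section Green.
Variables (R : realFieldType) (V : finType) (e : rel V).
Hypothesis e_sym : symmetric e.

Lemma sum_enum_val (F : V -> R) : \sum_(i < #|V|) F (enum_val i) = \sum_v F v.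
Proof. by rewrite [RHS]big_enum_val. Qed.

Lemma laplacian_tr : (laplacian R e)^T = laplacian R e.
Proof.
rewrite /laplacian linearB /= tr_diag_mx; congr (_ - _).
by apply/matrixP => i j; rewrite !mxE e_sym.
Qed.

Lemma laplacian_mul (p : nat) (M : 'M[R]_(#|V|, p)) i j :
  (laplacian R e *m M) i j =
  \sum_v (e (enum_val i) v)%:R * (M i j - M (enum_rank v) j).
Proof.
rewrite /laplacian mulmxBl mul_diag_mx !mxE.
under [RHS]eq_bigr => v _ do rewrite mulrBr.
rewrite sumrB -mulr_suml; congr (_ * _ - _).
  by rewrite -natr_sum -sum1dep_card big_mkcond.
rewrite -sum_enum_val; apply: eq_bigr => k _.
by rewrite !mxE enum_valK.
Qed.

(** The vector b = e_u - e_v is orthogonal to the all-ones vector, so the rank-one defect dies on it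
    and b = L (X b). Hence b lies in the range of L, as connectedness would ensure, and L L^+ L = L
    eliminates the pseudoinverse from b^T L^+ b. *)
Lemma resistance_green (X : V -> V -> R) (t : V -> R) :
  (forall u v, \sum_w (e u w)%:R * (X u v - X w v) = (u == v)%:R + t u) ->
  forall u v, resistance R e u v = X u u + X v v - X u v - X v u.
Proof.
move=> XP u v; rewrite /resistance.
set b := _ - _; set L := laplacian R e; set P := pinv L.
pose M := (\matrix_(i, j) X (enum_val i) (enum_val j) : 'M[R]_#|V|).
have LM : L *m M = 1%:M + (\col_i t (enum_val i)) *m const_mx 1.
  apply/matrixP => i j; rewrite laplacian_mul [RHS]mxE [_%:M _ _]mxE.
  rewrite [(_ *m _) _ _]mxE big_ord1 !mxE mulr1.
  rewrite -(inj_eq enum_val_inj) -XP; apply: eq_bigr => w _.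
  by rewrite mxE enum_rankK.
have b0 : (const_mx 1 : 'rV_#|V|) *m b = 0.
  apply/matrixP => i j; rewrite mulmxBr -!colE !mxE subrr //.
have LMb : L *m (M *m b) = b.
  by rewrite mulmxA LM mulmxDl mul1mx -mulmxA b0 mulmx0 addr0.
have /and4P[/eqP LPL _ _ _] := pinvP L.
rewrite -{1 2}LMb trmx_mul laplacian_tr !mulmxA.
rewrite -(mulmxA _ L P) -(mulmxA _ (L *m P) L) LPL -!mulmxA LMb.
(* X need not be symmetric, but a 1 by 1 matrix equals its transpose in its only entry. *)
have -> : (M *m b)^T *m b = (b^T *m (M *m b))^T by rewrite [RHS]trmx_mul trmxK.
have ME a c : ((unit_vector R a)^T *m (M *m unit_vector R c)) 0 0 = X a c.
  by rewrite /unit_vector trmx_delta -colE -rowE !mxE !enum_rankK.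
rewrite mxE /b linearB /= mulmxBl !mulmxBr.
have subE (A B : 'M[R]_1) : (A - B) 0 0 = A 0 0 - B 0 0 by rewrite !mxE.
by rewrite !subE !ME; ring.
Qed.

Lemma kirchhoff_green (X : V -> V -> R) (t : V -> R) :
  (forall u v, \sum_w (e u w)%:R * (X u v - X w v) = (u == v)%:R + t u) ->
  kirchhoff_index R e = #|V|%:R * (\sum_u X u u) - \sum_u \sum_v X u v.
Proof.
move=> /resistance_green rE; rewrite /kirchhoff_index.
have -> : \sum_u \sum_v resistance R e u v =
    \sum_u \sum_v (X u u + X v v - X u v - X v u).
  by apply: eq_bigr => u _; apply: eq_bigr => v _; exact: rE.
under eq_bigr => u _ do rewrite !sumrB big_split /= sumr_const.
rewrite !sumrB big_split /= sumr_const [X in _ - X]exchange_big /=.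
by rewrite sumrMnl -[(\sum__ _) *+ _]mulr_natl; field.
Qed.

End Green.

(** * The resistance kernel of a cycle of length 2n: second differences and sums *)

Section CycleKernel.
Variables (R : realFieldType) (n : nat).
Hypothesis n_gt0 : (0 < n)%N.

(* The resistance distance between positions p and q on a cycle of length 2n
   with unit edge resistances: d (2n - d) / 2n with d = |p - q|. *)
Definition cycle_res (p q : nat) : R :=
  `|p%:R - q%:R| - (p%:R - q%:R) ^+ 2 / (2 * n%:R).

Let n0 : n%:R != 0 :> R. Proof. by rewrite pnatr_eq0 -lt0n. Qed.

Lemma cycle_res_diag p : cycle_res p p = 0.
Proof. by rewrite /cycle_res subrr normr0 expr0n mul0r subrr. Qed.

Lemma normr_sub_le (p q : nat) : (p <= q)%N -> `|p%:R - q%:R| = q%:R - p%:R :> R.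
Proof. by move=> pq; rewrite ler0_norm ?opprB // subr_le0 ler_nat. Qed.

Lemma normr_sub_ge (p q : nat) : (q <= p)%N -> `|p%:R - q%:R| = p%:R - q%:R :> R.
Proof. by move=> pq; rewrite ger0_norm // subr_ge0 ler_nat. Qed.

(** The formula is not periodic in general; this is the one identification needed to close the
    cycle. *)
Lemma cycle_res_wrap q : (q <= n.*2)%N -> cycle_res n.*2 q = cycle_res 0 q.
Proof.
move=> q2n; rewrite /cycle_res normr_sub_ge // normr_sub_le // -mul2n natrM.
field; exact: n0.
Qed.

(** The kink of the absolute value at q gives the point mass 2, and the quadratic term gives the
    constant -1/n. *)
Lemma cycle_res_step p q :
  cycle_res p.+2 q + cycle_res p q - 2 * cycle_res p.+1 q
    = 2 * (p.+1 == q)%:R - n%:R^-1.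
Proof.
rewrite /cycle_res; case: (ltngtP p.+1 q) => [pq|qp|<-] /=.
- rewrite (normr_sub_le pq) normr_sub_le ?normr_sub_le //; try lia.
  by rewrite -!natr1; field; exact: n0.
- rewrite (normr_sub_ge (ltnW qp)) normr_sub_ge ?normr_sub_ge //; try lia.
  by rewrite -!natr1; field; exact: n0.
- rewrite (normr_sub_ge (leqnSn _)) (normr_sub_le (leqnSn _)) normr_sub_ge //.
  by rewrite -!natr1; field; exact: n0.
Qed.

Lemma cycle_res_step0 q : (q < n.*2)%N ->
  cycle_res 1 q + cycle_res n.*2.-1 q - 2 * cycle_res 0 q
    = 2 * (0%N == q)%:R - n%:R^-1.
Proof.
move=> q2n; rewrite /cycle_res.
have -> : (n.*2.-1)%:R = 2 * n%:R - 1 :> R.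
  by rewrite -subn1 natrB ?double_gt0 // -mul2n natrM.
case: q q2n => [|q] q2n.
  rewrite !subr0 normr0 normr1 ger0_norm; first by rewrite eqxx mulr1; field; exact: n0.
  by rewrite subr_ge0 -natrM (ler_nat R 1) mul2n double_gt0.
rewrite (_ : (0%N == q.+1) = false) // mulr0 normr_sub_le // normr_sub_le // ger0_norm.
  by rewrite -natr1; field; exact: n0.
rewrite subr_ge0 lerBrDr natr1 -natrM ler_nat; lia.
Qed.

Lemma sum_nat1 k : \sum_(i < k) (i%:R : R) = k%:R * (k%:R - 1) / 2.
Proof.
elim: k => [|k IH]; first by rewrite big_ord0 mul0r mul0r.
by rewrite big_ord_recr /= IH -natr1; field.
Qed.

Lemma sum_nat2 k :
  \sum_(i < k) (i%:R ^+ 2 : R) = k%:R * (k%:R - 1) * (2 * k%:R - 1) / 6.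
Proof.
elim: k => [|k IH]; first by rewrite big_ord0 !mul0r.
by rewrite big_ord_recr /= IH -natr1; field.
Qed.

Lemma sum_affine (a b : R) k :
  \sum_(i < k) (a + b * i%:R) = k%:R * a + b * (k%:R * (k%:R - 1) / 2).
Proof.
rewrite big_split /= sumr_const card_ord -mulr_sumr sum_nat1.
by rewrite -[a *+ k]mulr_natl.
Qed.

Lemma sum_affine_sqr (a b : R) k :
  \sum_(i < k) (a + b * i%:R) ^+ 2 =
    k%:R * a ^+ 2 + a * b * (k%:R * (k%:R - 1))
    + b ^+ 2 * (k%:R * (k%:R - 1) * (2 * k%:R - 1) / 6).
Proof.
have sqrE (i : 'I_k) : (a + b * i%:R) ^+ 2 =
    (a ^+ 2 + 2 * a * b * i%:R) + b ^+ 2 * i%:R ^+ 2 by ring.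
rewrite (eq_bigr _ (fun i _ => sqrE i)).
by rewrite big_split /= -mulr_sumr sum_affine sum_nat2; field.
Qed.

(** The number s marks where the sampled points q + 2j pass p, so the absolute value is affine in j
    on each side of s. *)
Lemma sum_cycle_res (p q s : nat) : (s <= n)%N ->
  (forall j, (j < s)%N -> (q + j.*2 <= p)%N) ->
  (forall j, (s <= j)%N -> (p <= q + j.*2)%N) ->
  \sum_(j < n) cycle_res p (q + j.*2)%N =
    (2 * s%:R - n%:R) * (p%:R - q%:R)
    - 2 * (s%:R * (s%:R - 1)) + n%:R * (n%:R - 1)
    - (n%:R * (p%:R - q%:R) ^+ 2 - 2 * (p%:R - q%:R) * (n%:R * (n%:R - 1))
       + 2 * (n%:R * (n%:R - 1) * (2 * n%:R - 1)) / 3) / (2 * n%:R).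
Proof.
move=> sn lo hi.
have [t nst] : exists t, (n = s + t)%N by exists (n - s)%N; rewrite subnKC.
rewrite /cycle_res sumrB -mulr_suml.
have dE j : p%:R - (q + j.*2)%:R = (p%:R - q%:R) + (- 2) * j%:R :> R.
  by rewrite natrD -mul2n natrM; ring.
have -> : \sum_(j < n) (p%:R - (q + j.*2)%:R) ^+ 2 =
    \sum_(j < n) ((p%:R - q%:R) + (- 2) * j%:R) ^+ 2 :> R.
  by apply: eq_bigr => j _; rewrite dE.
rewrite sum_affine_sqr.
have -> : \sum_(j < n) `|p%:R - (q + j.*2)%:R| =
   \sum_(j < s) ((p%:R - q%:R) + (- 2) * j%:R)
   + \sum_(j < t) ((q%:R - p%:R + 2 * s%:R) + 2 * j%:R) :> R.
  rewrite nst big_split_ord /=; congr (_ + _); apply: eq_bigr => j _.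
    by rewrite normr_sub_ge ?dE //; apply: lo.
  rewrite normr_sub_le; last by apply: hi; lia.
  by rewrite doubleD !natrD -!mul2n !natrM; ring.
rewrite !sum_affine.
have -> : t%:R = n%:R - s%:R :> R by rewrite nst natrD addrC addKr.
by field; exact: n0.
Qed.

Lemma sum_cycle_res_even (p q : nat) (i : 'I_n) : p = (q + i.*2)%N ->
  \sum_(j < n) cycle_res p (q + j.*2)%N = (n%:R ^+ 2 - 1) / 3.
Proof.
move=> pE; rewrite (@sum_cycle_res p q i); try by [move=> *; lia | exact: ltnW].
by rewrite pE natrD -mul2n natrM; field; exact: n0.
Qed.

(** Stating the parity condition on p + 1 includes the case p < q, namely p = 0, q = 1, s = 0. *)
Lemma sum_cycle_res_odd (p q s : nat) : (s <= n)%N -> (p.+1 = q + s.*2)%N ->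
  \sum_(j < n) cycle_res p (q + j.*2)%N = (2 * n%:R ^+ 2 + 1) / 6.
Proof.
move=> sn pE; rewrite (@sum_cycle_res p q s) //; try by move=> *; lia.
have -> : p%:R = q%:R + 2 * s%:R - 1 :> R.
  by apply: (addIr 1); rewrite natr1 pE natrD -mul2n natrM subrK.
by field; exact: n0.
Qed.

(* Cut vertices sit at the even positions, with multiplicity one, and the c
   private vertices of copy i at position 2 i + 1. *)
Lemma sum_cycle_res_weighted (c : R) :
  \sum_(i < n) \sum_(j < n)
     (cycle_res i.*2 j.*2 + c * cycle_res i.*2 j.*2.+1
      + c * (cycle_res i.*2.+1 j.*2 + c * cycle_res i.*2.+1 j.*2.+1)) =
  n%:R * ((1 + c ^+ 2) * (n%:R ^+ 2 - 1) / 3 + c * (2 * n%:R ^+ 2 + 1) / 3).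
Proof.
rewrite -[n in n%:R * _]card_ord mulr_natl -sumr_const; apply: eq_bigr => i _.
rewrite 2!big_split /= -!mulr_sumr.
rewrite [\sum_(_ < _) (cycle_res _.+1 _ + _)]big_split /= -mulr_sumr.
have -> : \sum_(j < n) cycle_res i.*2 j.*2 = (n%:R ^+ 2 - 1) / 3.
  exact: (sum_cycle_res_even (q := 0) (i := i)).
have -> : \sum_(j < n) cycle_res i.*2.+1 j.*2.+1 = (n%:R ^+ 2 - 1) / 3.
  exact: (sum_cycle_res_even (q := 1) (i := i)).
have -> : \sum_(j < n) cycle_res i.*2 j.*2.+1 = (2 * n%:R ^+ 2 + 1) / 6.
  exact: (sum_cycle_res_odd (q := 1) (ltnW (ltn_ord i))).
have -> : \sum_(j < n) cycle_res i.*2.+1 j.*2 = (2 * n%:R ^+ 2 + 1) / 6.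
  exact: (sum_cycle_res_odd (q := 0) (ltn_ord i)).
by field.
Qed.

End CycleKernel.

(** * Normal forms for the vertices of the quotient *)

Section FlowerVertices.
Variables (n : nat) (T : finType) (x y : T).
Hypothesis xy : x != y.

(* The representative of a glue class that is not of the form (i, y). *)
Definition nf (u : 'I_n * T) := if u.2 == y then (ordS u.1, x) else u.

Local Notation V := (flower_vertex n x y).
Definition pt (i : 'I_n) (z : T) : V := (\pi_V (i, z))%qT.

Lemma nf_neq u : (nf u).2 != y.
Proof. by rewrite /nf; case: ifP => // ->. Qed.

Lemma nf_id u : u.2 != y -> nf u = u.
Proof. by rewrite /nf => /negPf ->. Qed.

Lemma nf_step u v : glue_step x y u v -> nf u = nf v.
Proof.
case: u v => [i w] [j z] /and3P[/= /eqP -> /eqP -> /eqP ->].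
by rewrite /nf /= eqxx (negPf xy).
Qed.

Lemma glue_nf u : glue x y u (nf u).
Proof.
case: u => i z; rewrite /nf /=; case: eqP => [->|_]; last exact: glue_refl.
by apply: connect1; apply/orP; left; apply/and3P; split=> /=.
Qed.

(** Each glue step preserves [nf], hence so does every path; conversely each u is glued to
    [nf u]. *)
Lemma glueE u v : glue x y u v = (nf u == nf v).
Proof.
apply/idP/eqP => [/connectP[p pP ->{v}]|uv]; last first.
  by apply: glue_trans (glue_nf u) _; rewrite uv glue_sym glue_nf.
elim: p u pP => //= v p IH u /andP[uv /IH <-].
by case/orP: uv => /nf_step.
Qed.

Lemma pi_eq u v : (\pi_V u == \pi_V v)%qT = (nf u == nf v).
Proof. by rewrite -glueE piE. Qed.

Lemma pt_eq i z j w : (pt i z == pt j w) = (nf (i, z) == nf (j, w)).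
Proof. exact: pi_eq. Qed.

Lemma pt_inj i z j w : z != y -> w != y ->
  (pt i z == pt j w) = (i == j) && (z == w).
Proof. by move=> zy wy; rewrite pt_eq !nf_id. Qed.

Lemma pt_glue i : pt i y = pt (ordS i) x.
Proof. by apply/eqP; rewrite pt_eq /nf /= eqxx (negPf xy). Qed.

Lemma ptP (a : V) : exists i z, z != y /\ a = pt i z.
Proof.
elim/quotW: a => u; exists (nf u).1, (nf u).2; split; first exact: nf_neq.
by apply/eqP; rewrite /pt -surjective_pairing pi_eq (nf_id (nf_neq u)).
Qed.

(** Every class has exactly one representative (i, z) with z != y, found by [nf (repr a)]. *)
Lemma sum_flower (R : nmodType) (F : V -> R) :
  \sum_a F a = \sum_i \sum_(z | z != y) F (pt i z).
Proof.
rewrite (pair_big xpredT (fun z => z != y) (fun i z => F (pt i z))) /=.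
rewrite (reindex_onto (fun u => pt u.1 u.2) (fun a => nf (repr a))) /=; last first.
  move=> a _; rewrite /pt -surjective_pairing -[RHS]reprK.
  by apply/eqP; rewrite pi_eq nf_id // nf_neq.
apply: eq_bigl => -[i z] /=; apply/eqP/idP => [e|zy].
  by have := nf_neq (repr (pt i z)); rewrite e.
rewrite -[RHS](nf_id (u := (i, z))) //; apply/eqP.
by rewrite -pi_eq reprK.
Qed.

End FlowerVertices.

(** * Adjacency in the complete flower *)

Section CompleteFlower.
Variables (R : realFieldType) (m n : nat) (x y : 'I_m).
Hypotheses (n_ge3 : (3 <= n)%N) (xy : x != y).

Local Notation V := (flower_vertex n x y).
Local Notation e := (flower_graph n (complete_graph m) x y).
Local Notation pt := (@pt n _ x y).
Local Notation g := (cycle_res R n).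

Lemma flower_sym : symmetric e.
Proof.
move=> a b; rewrite /flower_graph /= eq_sym; congr (_ && _).
by apply/existsP/existsP => -[u /existsP[v /and3P[ua vb /andP[uv1 uv2]]]];
   exists v; apply/existsP; exists u; apply/and3P;
   split=> //; apply/andP; split; rewrite /complete_graph /= eq_sym.
Qed.

(** Besides its normal forms (i, z), copy i contains y_i, whose normal form is x of copy i + 1; the
    last two alternatives account for an endpoint of that kind. *)
Lemma flower_adj i z j w : z != y -> w != y ->
  e (pt i z) (pt j w) = ((i, z) != (j, w)) &&
    [|| i == j, (w == x) && (j == ordS i) | (z == x) && (i == ordS j)].
Proof.
move=> zy wy; rewrite /flower_graph /= pt_eq // !nf_id //.
apply: andb_id2l => ne; apply/existsP/idP.
  case=> -[a p] /existsP[[b q] /and3P[]].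
  rewrite !pi_eq // [nf _ _ (i, z)]nf_id // [nf _ _ (j, w)]nf_id // => ua vb.
  case/andP=> /= /eqP ab pq; move: ua vb; rewrite -{}ab /nf /=.
  case: (p =P y) (q =P y) => [py|_] [qy|_] /eqP[<- <-] /eqP[<- <-];
    by rewrite ?eqxx ?orbT.
case/or3P=> [/eqP ij|/andP[/eqP wx /eqP jE]|/andP[/eqP zx /eqP iE]].
- exists (i, z); apply/existsP; exists (j, w).
  rewrite !eqxx /copies /complete_graph /= ij eqxx /=; apply: contraNneq ne => ->.
  by rewrite ij.
- exists (i, z); apply/existsP; exists (i, y).
  by rewrite !pi_eq // /copies /complete_graph /= zy jE wx /nf /= (negPf xy) !eqxx.
- exists (j, y); apply/existsP; exists (j, w).
  by rewrite !pi_eq // /copies /complete_graph /= (eq_sym y) wy iE zx /nf /= (negPf xy) !eqxx.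
Qed.

Lemma ordS_neq (i : 'I_n) : ordS i != i.
Proof.
rewrite -val_eqE /=; have ni := ltn_ord i.
have [e1 |ne] := eqVneq i.+1 n; first by rewrite e1 modnn; lia.
by rewrite modn_small; lia.
Qed.

(** This uses n >= 3: with two copies, both cut vertices would lie in both copies and their edge
    would be counted twice. *)
Lemma ordS2_neq (i : 'I_n) : ordS (ordS i) != i.
Proof.
rewrite -val_eqE /=; have ni := ltn_ord i.
have [e1 |ne] := eqVneq i.+1 n; first by rewrite e1 modnn modn_small; lia.
rewrite (@modn_small i.+1); last by lia.
have [e2 |ne2] := eqVneq i.+2 n; first by rewrite e2 modnn; lia.
by rewrite modn_small; lia.
Qed.

(** The alternatives of adjacency exclude each other, so their disjunction becomes a sum; the extra
    term on the left balances i == j on the diagonal. *)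
Lemma flower_adj_nat i z j w : z != y -> w != y ->
  (e (pt i z) (pt j w) + ((i, z) == (j, w)) =
   (i == j) + (w == x) * (j == ordS i) + (z == x) * (i == ordS j))%N.
Proof.
move=> zy wy; rewrite flower_adj //.
have [[<- <-]|ne] := eqVneq (i, z) (j, w).
  by rewrite eqxx (eq_sym i) (negPf (ordS_neq i)) !muln0.
rewrite /= addn0; have [ij|_] /= := eqVneq i j.
  by rewrite ij (eq_sym j) (negPf (ordS_neq j)) !muln0.
have [->|_] := eqVneq j (ordS i); last by rewrite andbF muln0 mulnb.
by rewrite (eq_sym i) (negPf (ordS2_neq i)) andbF muln0 andbT orbF muln1 addn0.
Qed.

(** The neighbours of a vertex fill the copies containing it: one copy, or two at a cut vertex. As D
    vanishes at the vertex itself, whole copies may be summed. *)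
Lemma flower_adj_sum (D : V -> R) i z : z != y -> D (pt i z) = 0 ->
  \sum_a (e (pt i z) a)%:R * D a =
    \sum_k D (pt i k) + (z == x)%:R * \sum_k D (pt (ord_pred i) k).
Proof.
move=> zy D0; rewrite (sum_flower xy) //.
transitivity (\sum_j \sum_(w | w != y)
   ((i == j)%:R * D (pt j w) + (w == x)%:R * ((j == ordS i)%:R * D (pt j w))
    + (z == x)%:R * ((i == ordS j)%:R * D (pt j w)))).
  apply: eq_bigr => j _; apply: eq_bigr => w wy.
  have -> : (e (pt i z) (pt j w))%:R * D (pt j w) =
      (e (pt i z) (pt j w) + ((i, z) == (j, w)))%:R * D (pt j w).
    rewrite natrD mulrDl; case: eqVneq => [[<- <-]|_]; last by rewrite mul0r addr0.
    by rewrite D0 !mulr0 addr0.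
  by rewrite flower_adj_nat // !natrD !natrM; ring.
have S j0 (b : 'I_n -> bool) (E : 'I_n -> 'I_m -> R) :
    b =1 pred1 j0 ->
    \sum_j \sum_(w | w != y) (b j)%:R * E j w = \sum_(w | w != y) E j0 w.
  move=> bE; rewrite (bigD1 j0) //= [X in _ + X]big1 => [|j jj0].
    by rewrite addr0; apply: eq_bigr => w _; rewrite bE /= eqxx mul1r.
  by rewrite big1 // => w _; rewrite bE /= (negPf jj0) mul0r.
under eq_bigr => j _ do rewrite !big_split /=.
rewrite !big_split /=.
rewrite (S i); last by move=> j; rewrite eq_sym.
rewrite (eq_bigr (fun j => \sum_(w | w != y)
    (j == ordS i)%:R * ((w == x)%:R * D (pt j w)))); last first.
  by move=> j _; apply: eq_bigr => w _; rewrite mulrCA.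
rewrite (S (ordS i)) //.
rewrite (eq_bigr (fun j => \sum_(w | w != y)
    (i == ordS j)%:R * ((z == x)%:R * D (pt j w))) (P := predT)); last first.
  by move=> j _; apply: eq_bigr => w _; rewrite mulrCA.
rewrite (S (ord_pred i)); last first.
  by move=> j /=; apply/eqP/eqP => ->; rewrite ?ordSK ?ord_predK.
(* The only surviving term of copy i + 1 is its x, that is y_i, which completes the sum over copy
   i. *)
rewrite [X in _ + X + _](bigD1 x) //= eqxx mul1r.
rewrite [X in _ + (_ + X) + _]big1 => [|w /andP[_ /negPf->]]; last by rewrite mul0r.
rewrite addr0 -pt_glue // -mulr_sumr; congr (_ + _).
  by rewrite [RHS](bigD1 y) //= addrC.
(* The term k = y absent from copy i - 1 is the vertex x_i itself, where D is zero. *)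
have [zx|_] := eqVneq z x; last by rewrite !mul0r.
move: D0; rewrite zx => D0.
by rewrite [in RHS](bigD1 y) //= pt_glue // ord_predK D0 add0r.
Qed.

(** * Positions on the reduced cycle, private vertices sharing that of their hub, and the Green
    equation *)

Definition pos (a : V) : nat :=
  ((nf x y (repr a)).1.*2 + ((nf x y (repr a)).2 != x))%N.

Lemma pos_pt i z : z != y -> pos (pt i z) = (i.*2 + (z != x))%N.
Proof.
move=> zy; suff -> : pos (pt i z) =
    ((nf x y (i, z)).1.*2 + ((nf x y (i, z)).2 != x))%N.
  by rewrite nf_id.
rewrite /pos; have /eqP -> // : nf x y (repr (pt i z)) == nf x y (i, z).
by rewrite -pi_eq // reprK.
Qed.

Lemma pos_cut i : pos (pt i x) = i.*2.
Proof. by rewrite pos_pt // eqxx addn0. Qed.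

Lemma pos_private i z : z != x -> z != y -> pos (pt i z) = i.*2.+1.
Proof. by move=> zx zy; rewrite pos_pt // zx addn1. Qed.

Lemma pos_lt (a : V) : (pos a < n.*2)%N.
Proof. rewrite /pos; case: nf => i z /=; have := ltn_ord i; lia. Qed.

Lemma card_private : #|[pred k : 'I_m | (k != y) && (k != x)]|%:R = m%:R - 2 :> R.
Proof.
have -> : #|[pred k : 'I_m | (k != y) && (k != x)]| = (m - 2)%N.
  have -> : 2%N = #|[set x; y]| by rewrite cards2 xy.
  rewrite -[m in (m - _)%N]card_ord -cardsT -cardsDS ?subsetT //.
  by rewrite -cardsE; apply: eq_card => k; rewrite !inE negb_or andbT andbC.
by rewrite natrB //; have := ltn_ord x; have := ltn_ord y; move: xy; rewrite -val_eqE /=; lia.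
Qed.

Lemma sum_pos (F : nat -> R) :
  \sum_a F (pos a) = \sum_(i < n) (F i.*2 + (m%:R - 2) * F i.*2.+1).
Proof.
rewrite (sum_flower xy); apply: eq_bigr => i _.
rewrite (bigD1 x) //= pos_cut -card_private; congr (_ + _).
rewrite (eq_bigr (fun=> F i.*2.+1)) => [|z /andP[zy zx]].
  by rewrite sumr_const mulr_natl.
by rewrite pos_private.
Qed.

(* Minus half the resistance distance, up to terms depending on only one of
   a and b; odd positions are those of the private vertices, which hang from
   the cycle by a pendant edge of resistance 1/m. *)
Definition green (a b : V) : R :=
  ((a == b) && odd (pos a))%:R / m%:R - g (pos a) (pos b) / (2 * m%:R).

Let n_gt0 : (0 < n)%N. Proof. exact: leq_trans n_ge3. Qed.

Let m0 : m%:R != 0 :> R.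
Proof. by rewrite pnatr_eq0; case: m x => // -[]. Qed.

Let n0 : n%:R != 0 :> R. Proof. by rewrite pnatr_eq0 -lt0n. Qed.

(** Second difference at the hub 2i + 1; for the last copy the right neighbour wraps to 0. *)
Lemma cycle_res_copy (i : 'I_n) q : (q < n.*2)%N ->
  g i.*2 q + g (ordS i).*2 q =
    2 * g i.*2.+1 q + 2 * (i.*2.+1 == q)%:R - n%:R^-1.
Proof.
move=> q2n; have := cycle_res_step R n_gt0 i.*2 q.
have -> : g (ordS i).*2 q = g i.*2.+2 q.
  have [e1|ne] := eqVneq i.+1 n.
    by rewrite /= e1 modnn -doubleS e1 cycle_res_wrap // ltnW.
  by rewrite /= modn_small // ltn_neqAle ne ltn_ord.
by move=> h; lra.
Qed.

Lemma cycle_res_cut (i : 'I_n) q : (q < n.*2)%N ->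
  g i.*2.+1 q + g (ord_pred i).*2.+1 q =
    2 * g i.*2 q + 2 * (i.*2 == q)%:R - n%:R^-1.
Proof.
move=> q2n; case: i => -[|i] lin /=.
  have := cycle_res_step0 R n_gt0 q2n; rewrite add0n modn_small; last by lia.
  rewrite (_ : n.-1.*2.+1 = n.*2.-1) => [h|]; [lra | lia].
have := cycle_res_step R n_gt0 i.*2.+1 q.
rewrite modnDr modn_small; last by lia.
by rewrite doubleS => h; lra.
Qed.

Lemma sum_copy (D : 'I_m -> R) c : (forall k, k != y -> k != x -> D k = c) ->
  \sum_k D k = D x + D y + (m%:R - 2) * c.
Proof.
move=> Dc; rewrite (bigD1 y) //= (bigD1 x) //= -card_private.
rewrite (eq_bigr (fun=> c)) => [|k /andP[ky kx]]; last exact: Dc.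
by rewrite sumr_const mulr_natl addrA (addrC (D y)).
Qed.

(** The second difference at the hub turns the two cut values into hub values, and its point mass
    cancels the pendant term 1/m of [green]. *)
Lemma green_copy_sum i b :
  \sum_k green (pt i k) b =
    - (2^-1 * g i.*2.+1 (pos b)) + (2 * m%:R * n%:R)^-1.
Proof.
rewrite /green sumrB -!mulr_suml.
rewrite [X in _ - X / _](sum_copy (c := g i.*2.+1 (pos b))); last first.
  by move=> k ky kx; rewrite pos_private.
rewrite pos_cut pt_glue // pos_cut cycle_res_copy ?pos_lt //.
(* The pendant term counts the private vertices of copy i equal to b: one if b is such a vertex,
   otherwise none. *)
have -> : \sum_k ((pt i k == b) && odd (pos (pt i k)))%:R =
    (i.*2.+1 == pos b)%:R :> R.
  have [j [w [wy ->]]] := ptP xy b.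
  rewrite pos_pt //; have [->|wx] := eqVneq w x.
    rewrite addn0 big1 => [|k _]; first by rewrite (_ : _ == _ = false) //; lia.
    have [->|ky] := eqVneq k y; first by rewrite pt_glue // pos_cut odd_double andbF.
    rewrite pt_inj //; have [->|_] := eqVneq k x; last by rewrite andbF.
    by rewrite pos_cut odd_double andbF.
  rewrite (bigD1 w) //= pt_inj // eqxx andbT pos_private //= odd_double andbT.
  rewrite big1 => [|k kw].
    by rewrite addr0 addn1 eqSS (inj_eq double_inj).
  have [->|ky] := eqVneq k y; first by rewrite pt_glue // pos_cut odd_double andbF.
  by rewrite pt_inj // (negPf kw) andbF.
by field; rewrite m0 n0.
Qed.

(** At a private vertex the kernel terms cancel and the pendant term leaves the unit mass. At a cut
    vertex the two copy sums give neighbouring hub values, and the second difference at 2i supplies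
    the mass. The remaining constant depends only on the parity of [pos a]. *)
Lemma green_eq a b :
  \sum_c (e a c)%:R * (green a b - green c b) =
    (a == b)%:R - (if odd (pos a) then (2 * m%:R * n%:R)^-1
                   else (2 * n%:R)^-1 + (m%:R * n%:R)^-1).
Proof.
have [i [z [zy ->]]] := ptP xy a.
rewrite (flower_adj_sum (D := fun c => green (pt i z) b - green c b)) ?subrr //.
have copyE j : \sum_k (green (pt i z) b - green (pt j k) b) =
    m%:R * green (pt i z) b - \sum_k green (pt j k) b.
  by rewrite sumrB sumr_const card_ord mulr_natl.
rewrite !copyE !green_copy_sum.
set q := pos b; have q2n : (q < n.*2)%N by exact: pos_lt.
have [zx|zx] := eqVneq z x.
  rewrite zx mul1r {1 2}/green pos_cut odd_double andbF mul0r -/q.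
  (* An even position carries a single vertex, so there equality of positions is equality of
     vertices. *)
  have -> : (pt i x == b) = (i.*2 == q).
    rewrite /q; have [j [w [wy ->]]] := ptP xy b.
    rewrite pt_inj // pos_pt // eq_sym.
    have [_|_] := eqVneq w x; rewrite ?andbT ?andbF.
      by rewrite addn0 (inj_eq double_inj) eq_sym.
    by symmetry; apply/eqP; lia.
  have gE : g (ord_pred i).*2.+1 q =
      2 * g i.*2 q + 2 * (i.*2 == q)%:R - n%:R^-1 - g i.*2.+1 q.
    by rewrite -cycle_res_cut //; ring.
  by rewrite gE; field; rewrite m0 n0.
rewrite mul0r addr0 {1}/green pos_private //= odd_double andbT -/q /=.
by field; rewrite m0 n0.
Qed.

(** * Vertex count and the sums of the Green matrix *)

Lemma card_flower : #|{: V}|%:R = n%:R * (m%:R - 1) :> R.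
Proof.
rewrite -sum1_card natr_sum (sum_pos (fun=> 1)) sumr_const card_ord.
by rewrite -[_ *+ n]mulr_natl; ring.
Qed.

Lemma sum_odd_pos : \sum_(a : V) (odd (pos a))%:R = n%:R * (m%:R - 2) :> R.
Proof.
rewrite (sum_pos (fun p => (odd p)%:R)).
rewrite (eq_bigr (fun=> m%:R - 2)) => [|i _].
  by rewrite sumr_const card_ord mulr_natl.
by rewrite /= odd_double add0r mulr1.
Qed.

Lemma sum_green_diag : \sum_a green a a = n%:R * (m%:R - 2) / m%:R.
Proof.
rewrite -sum_odd_pos mulr_suml; apply: eq_bigr => a _.
by rewrite /green eqxx cycle_res_diag mul0r subr0.
Qed.

(** The pendant term contributes only for a = b; the rest depends on positions alone and is the
    weighted cycle sum with c = m - 2. *)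
Lemma sum_green : \sum_a \sum_b green a b =
  n%:R * (m%:R - 2) / m%:R
  - n%:R * ((1 + (m%:R - 2) ^+ 2) * (n%:R ^+ 2 - 1) / 3
            + (m%:R - 2) * (2 * n%:R ^+ 2 + 1) / 3) / (2 * m%:R).
Proof.
rewrite -(sum_cycle_res_weighted n_gt0) -sum_odd_pos /green.
under eq_bigr => a _ do rewrite sumrB -!mulr_suml.
rewrite sumrB -!mulr_suml; congr (_ / _ - _ / _).
  apply: eq_bigr => a _; rewrite (bigD1 a) //= eqxx big1 ?addr0 // => b.
  by rewrite eq_sym => /negPf->.
rewrite (sum_pos (fun p => \sum_b g p (pos b))); apply: eq_bigr => i _.
rewrite (sum_pos (g i.*2)) (sum_pos (g i.*2.+1)) mulr_sumr -big_split /=.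
by apply: eq_bigr => j _.
Qed.

End CompleteFlower.

Theorem theorem4p5 (R : realFieldType) (m n : nat) (hm : (3 <= m)%N)
    (hn : (3 <= n)%N) (x y : 'I_m) (hxy : x != y) :
  kirchhoff_index R (flower_graph n (complete_graph m) x y) =
    (n%:R * (5 + 12 * n%:R + n%:R ^+ 2
             + m%:R ^+ 2 * (- 1 + 6 * n%:R + n%:R ^+ 2)
             - m%:R * (1 + 18 * n%:R + 2 * n%:R ^+ 2)))
    / (6 * m%:R).
Proof.
rewrite (kirchhoff_green (@flower_sym m n x y) (green_eq R hn hxy)).
rewrite sum_green_diag // sum_green // card_flower //.
have m0 : m%:R != 0 :> R by rewrite pnatr_eq0 -lt0n (leq_trans _ hm).
by field.
Qed.
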